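(* There is an absolute constant $C>0$ such that the following holds. Let $m,n\ge 2$, and let $\mathcal{G}=(G_1,\dots,G_T)$ be an always-connected temporal graph whose underlying graph is the $m\times n$ grid graph, with average degree $\Delta$. Put \[ f=n^{4/3}m^{16/3}\Delta^{1.5}\log^{2.5}(nm), \] and suppose $T\ge Cf$. Then a single agent starting at any given vertex can visit all vertices of $\mathcal{G}$ using only the snapshots $G_1,\dots,G_{\lceil Cf\rceil}$.
   Context: A temporal graph $\mathcal{G}=(G_1,\dots,G_T)$ on a vertex set $V$ is a sequence of simple undirected graphs $G_t=(V,E_t)$. It is always-connected if each $G_t$ is connected. Its underlying graph is $U=(V,\bigcup_tE_t)$, with average degree $\Delta=\frac1{|V|}\sum_v\deg_U(v)$. The $m\times n$ grid graph has vertex set $[m]\times[n]$, and $(i,j),(i',j')$ are adjacent iff $|i-i'|+|j-j'|=1$. A temporal walk is a sequence $((v_0,v_1),t_1),\dots,((v_{\ell-1},v_\ell),t_\ell)$ with $\{v_{j-1},v_j\}\in E_{t_j}$ and $t_1<\dots<t_\ell$. Waiting is allowed, and the walk visits $v_0,\dots,v_\ell$. *)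

(* Defs.v *)
From mathcomp Require Import all_boot all_order all_algebra.
From mathcomp Require Import reals exp.

Set Implicit Arguments.
Unset Strict Implicit.
Unset Printing Implicit Defensive.

Import Order.TTheory GRing.Theory Num.Theory.

Local Open Scope ring_scope.

Record sgraph (V : finType) := SGraph {
  adj :> rel V;
  adj_sym : symmetric adj;
  adj_irrefl : irreflexive adj
}.

Definition connected_graph (V : finType) (G : sgraph V) : Prop :=
  forall u v : V, connect G u v.

Definition degree (V : finType) (G : sgraph V) (v : V) : nat :=
  #|[set u | G v u]|.

Definition avg_degree (R : realType) (V : finType) (G : sgraph V) : R :=
  (\sum_(v : V) degree G v)%N%:R / #|V|%:R.

(* Snapshots are indexed from 0: G t is the snapshot written G_(t+1) when
   they are numbered 1, ..., T. *)
Definition temporal_graph (V : finType) (T : nat) : Type := 'I_T -> sgraph V.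

Definition always_connected (V : finType) (T : nat)
    (G : temporal_graph V T) : Prop :=
  forall t : 'I_T, connected_graph (G t).

Section Underlying.
Variables (V : finType) (T : nat) (G : temporal_graph V T).

Definition underlying_adj : rel V := fun u v => [exists t : 'I_T, G t u v].

Fact underlying_adj_sym : symmetric underlying_adj.
Proof. by move=> u v; apply: eq_existsb => t; rewrite adj_sym. Qed.

Fact underlying_adj_irrefl : irreflexive underlying_adj.
Proof. by move=> u; apply/existsP => -[t]; rewrite adj_irrefl. Qed.

Definition underlying : sgraph V :=
  SGraph underlying_adj_sym underlying_adj_irrefl.

End Underlying.

Section Grid.
Variables m n : nat.

Definition grid_adj : rel ('I_m * 'I_n) := fun u v =>
  `|(u.1 : nat)%:Z - (v.1 : nat)%:Z| + `|(u.2 : nat)%:Z - (v.2 : nat)%:Z|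
    == 1 :> int.

Fact grid_adj_sym : symmetric grid_adj.
Proof. by move=> u v; rewrite /grid_adj distrC [X in _ + X]distrC. Qed.

Fact grid_adj_irrefl : irreflexive grid_adj.
Proof. by move=> u; rewrite /grid_adj !subrr. Qed.

Definition grid : sgraph ('I_m * 'I_n)%type := SGraph grid_adj_sym grid_adj_irrefl.

End Grid.

Section TemporalWalk.
Variables (V : finType) (T : nat) (G : temporal_graph V T).

(* A step ((u, v), t) moves from u to v in snapshot t. *)
Definition tstep : Type := ((V * V) * 'I_T)%type.

(* Times need only increase strictly, so the agent may wait between steps; the
   empty walk stays at v0. *)
Definition temporal_walk (v0 : V) (w : seq tstep) : bool :=
  [&& all (fun s : tstep => G s.2 s.1.1 s.1.2) w,
      sorted (fun s s' : tstep => (s.1.2 == s'.1.1) && (s.2 < s'.2)%N) w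
    & (if w is s :: _ then s.1.1 == v0 else true)].

Definition visited (v0 : V) (w : seq tstep) : seq V :=
  v0 :: [seq s.1.2 | s : tstep <- w].

Definition within_first (k : nat) (w : seq tstep) : bool :=
  all (fun s : tstep => (s.2 < k)%N) w.

Definition explorable_from (v0 : V) (k : nat) : Prop :=
  exists w : seq tstep,
    [/\ temporal_walk v0 w, within_first k w
      & forall v : V, v \in visited v0 w].

End TemporalWalk.

(* Main.v *)
Require Import Defs.
From mathcomp Require Import all_boot all_order all_algebra.
From mathcomp Require Import reals exp.
From mathcomp Require Import zify ring lra.

Set Implicit Arguments.
Unset Strict Implicit.
Unset Printing Implicit Defensive.

(** If u and v lie in a common component of the snapshot induced on S in at
    least #|S| of the snapshots of some period, then u reaches v within it, and
    vice versa. A strip of consecutive columns is joined to the rest of the grid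
    only through its two extreme columns, so inside it every vertex is at any
    time connected to one of 2m hubs.

    Cut the grid into blocks and every block into narrow substrips. At each time
    a vertex x is linked to a hub g of its substrip, and g to a hub h of its
    block. Time is divided into short windows and, by averaging, for some pair
    (g, h) a 1/m^2 fraction of the (vertex, window) pairs carry the label (g, h)
    throughout a round trip: an agent waiting at h goes to g, makes round trips
    to a fraction of the unvisited vertices of the substrip, and comes back to h
    in time for the next substrip. Treating every substrip of one block in turn
    costs about as much as travelling to that block. With n ~ a^3 m^2, substrips
    of width a and blocks of a/m substrips, a round takes O(a^3 m^3) snapshots
    and visits a fraction of order 1/(a m^5) of the unvisited vertices, so
    O(a m^5 log(nm)) rounds suffice; this is within the bound because
    a^4 m^8 ~ n^(4/3) m^(16/3). For n < 64 m^5 visiting the vertices one by one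
    is good enough. *)

Local Open Scope nat_scope.

(** * Averages and counts over time windows *)

Lemma exists_ge_average (I : finType) (i0 : I) (F : I -> nat) :
  exists i, \sum_j F j <= #|I| * F i.
Proof.
exists [arg max_(i > i0) F i]; rewrite -sum_nat_const.
by apply: leq_sum => j _; case: arg_maxnP => // i _; apply.
Qed.

(** The partial sums grow by at most one per step, so none of the values up to [k] is skipped. *)
Lemma sum_crossing (f : nat -> bool) a b k :
  a <= b -> k <= \sum_(a <= t < b) f t ->
  exists c, [/\ a <= c <= b, \sum_(a <= t < c) f t = k
    & \sum_(a <= t < b) f t = k + \sum_(c <= t < b) f t].
Proof.
elim: b => [|b IHb] leab.
  by move: leab; rewrite leqn0 => /eqP->; rewrite big_geq // leqn0 => /eqP->;
    exists 0; rewrite !big_geq.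
move: leab; rewrite leq_eqVlt => /predU1P[<-|]; first by
  rewrite big_geq // leqn0 => /eqP->; exists a; rewrite !big_geq // !leqnn.
rewrite ltnS => leab; have [le_k _|lt_k] := leqP k (\sum_(a <= t < b) f t).
  have [c [/andP[ac cb] ck e]] := IHb leab le_k.
  exists c; split; rewrite ?ac ?leqW //.
  by rewrite !big_nat_recr //= e addnA.
move=> le_k; exists b.+1; split; rewrite ?leqnn ?leqW //; last first.
  rewrite [X in _ + X]big_geq // addn0; apply/eqP; rewrite eqn_leq le_k andbT.
  by rewrite big_nat_recr //=; case: (f b); lia.
apply/eqP; rewrite eqn_leq le_k andbT.
by rewrite big_nat_recr //=; case: (f b); lia.
Qed.

(** The counted part never exceeds the sum so far. A new index is counted only while that sum is
    below [M], so the count ends at most [d] above [M]. *)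
Lemma prefix_heavy_count (f : nat -> nat) d M K :
  let c := d * \sum_(i < K) (d <= f i) && (\sum_(k < i) f k < M) in
  c <= \sum_(i < K) f i /\ c <= M + d.
Proof.
elim: K => [|K /= [IH1 IH2]]; first by rewrite /= !big_ord0 muln0.
rewrite /= !big_ord_recr /= mulnDr.
by case: (leqP d (f K)) => h1; case: ltnP => h2 /=; lia.
Qed.

Lemma suffix_heavy_count (f : nat -> nat) d M K :
  let c := d * \sum_(i < K) (d <= f i) && (\sum_(i.+1 <= k < K) f k < M) in
  c <= \sum_(i < K) f i /\ c <= M + d.
Proof.
elim: K f => [|K IHK] f; first by rewrite /= !big_ord0 muln0.
rewrite /= !big_ord_recl /= mulnDr.
have [IH1 IH2] := IHK (f \o S).
have e0 : \sum_(1 <= k < K.+1) f k = \sum_(i < K) (f \o S) i.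
  by rewrite big_add1 big_mkord.
have e : \sum_(i < K) (d <= f (bump 0 i)) && (\sum_((bump 0 i).+1 <= k < K.+1) f k < M)
  = \sum_(i < K) (d <= (f \o S) i) && (\sum_(i.+1 <= k < K) (f \o S) k < M).
  by apply: eq_bigr => i _; rewrite [in LHS]big_add1.
rewrite e e0 in IH1 IH2 *.
have -> : \sum_(i < K) f (bump 0 i) = \sum_(i < K) (f \o S) i by [].
move: (\sum_(i < K) (f \o S) i) (\sum_(i < K) _) IH1 IH2 => p c IH1 IH2.
by case: (leqP d (f 0)) => h1; case: (ltnP p M) => h2 /=; lia.
Qed.

Lemma sum_windows (f : nat -> nat) s q i j : i <= j ->
  \sum_(i <= k < j) \sum_(s + k * q <= t < s + k.+1 * q) f t =
  \sum_(s + i * q <= t < s + j * q) f t.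
Proof.
elim: j => [|j IHj]; first by rewrite leqn0 => /eqP->; rewrite !big_geq.
rewrite leq_eqVlt => /predU1P[->|leij]; first by rewrite !big_geq.
rewrite big_nat_recr //= IHj // [RHS](big_cat_nat (n := s + j * q)) //=.
  by rewrite leq_add2l leq_mul2r -ltnS leij orbT.
by rewrite leq_add2l leq_mul2r leqnSn orbT.
Qed.

(** * Tours and reachability inside a vertex set *)

Lemma connect_leave (V : finType) (e : rel V) (A : {set V}) u v :
  connect e u v -> u \in A -> v \notin A ->
  exists x y, [/\ x \in A, y \notin A & e x y].
Proof.
case/connectP => p; elim: p u => [|y p IHp] u /=; first by move=> _ -> ->.
case/andP=> euy py ev uA vA; case: (boolP (y \in A)) => yA.
  exact: IHp py ev yA vA.
by exists u, y.
Qed.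

Section Exploration.
Variables (V : finType) (E : nat -> sgraph V).
Implicit Types (S B X Y A : {set V}) (u v x y : V).

(** This relation is reflexive everywhere, even at vertices outside [S]. *)
Definition conn_in S t : rel V :=
  connect [rel x y | [&& E t x y, x \in S & y \in S]].

Lemma conn_in_sym S t u v : conn_in S t u v = conn_in S t v u.
Proof.
apply: sym_connect_sym => x y /=.
by rewrite adj_sym [(x \in S) && _]andbC.
Qed.

Lemma conn_in_mem S t u v : u \in S -> conn_in S t u v -> v \in S.
Proof.
move=> uS c; apply/negPn/negP => vS.
have [x [y [_ /negP yS /= /and3P[_ _ //]]]] := connect_leave c uS vS.
Qed.

(** Follow a path of the snapshot from [x] to [d] and stop before it first leaves [S]; [d] itself
    may lie outside [S]. *)
Lemma conn_in_hub S (D : pred V) t x d :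
  connected_graph (E t) -> d \in D ->
  (forall y z, y \in S -> z \notin S -> E t y z -> y \in D) ->
  x \in S -> exists2 y, y \in D & conn_in S t x y.
Proof.
move=> conE dD bdry; case/connectP: (conE x d) => p.
elim: p x => [|y p IHp] x /=; first by move=> _ <- _; exists d => //; exact: connect0.
case/andP=> exy py ed xS; have [yS|yS] := boolP (y \in S).
  have [z zD cyz] := IHp _ py ed yS; exists z => //.
  by apply: connect_trans cyz; apply: connect1; rewrite /= exy xS.
by exists x; [exact: bdry exy | exact: connect0].
Qed.

(* [tour a u b v X]: an agent standing at u when snapshot a begins can stand
   at v when snapshot b begins, having visited X in the meantime. *)
Inductive tour : nat -> V -> nat -> V -> {set V} -> Prop :=
| tour_nil t u (X : {set V}) of X \subset [set u] : tour t u t u X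
| tour_step a u t v w (X Y : {set V}) of tour a u t v X & (v == w) || E t v w
    & Y \subset w |: X : tour a u t.+1 w Y.

Lemma tour_sub a u b v X Y : Y \subset X -> tour a u b v X -> tour a u b v Y.
Proof.
move=> YX t; case: t YX => {}a {}u.
  by move=> ? Xu YX; apply: tour_nil; apply: subset_trans Xu.
move=> t {}v w X' Y' h e YX' YX.
by apply: tour_step h e _; apply: subset_trans YX'.
Qed.

Lemma tour_cat a u b v c w X Y :
  tour a u b v X -> tour b v c w Y -> tour a u c w (X :|: Y).
Proof.
move=> tX tY; elim: tY X tX => {b v c w Y} [b v Y Yv|b v t w z Y Y' _ IH e sub] X tX.
  case: tX Yv => {a u b v X} [a u X Xu|a u t v w X X' h e sub] Yv.
    by apply: tour_nil; rewrite subUset Xu.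
  apply: tour_step h e _; rewrite subUset sub /=.
  by apply: subset_trans Yv _; rewrite subsetUl.
apply: tour_step (IH _ tX) e _; rewrite subUset; apply/andP; split.
  by rewrite setUCA subsetUl.
by apply: subset_trans sub _; rewrite setUS // subsetUr.
Qed.

Lemma tour_wait a b u : a <= b -> tour a u b u [set u].
Proof.
elim: b => [|b IHb]; first by rewrite leqn0 => /eqP->; apply: tour_nil.
rewrite leq_eqVlt => /predU1P[->|]; first exact: tour_nil.
by move=> /IHb h; apply: tour_step h _ _; rewrite ?eqxx // subsetUl.
Qed.

Lemma tour_end a b u v X : tour a u b v X -> tour a u b v (v |: X).
Proof. by move=> h; rewrite setUC; apply: tour_cat h (tour_wait v (leqnn b)). Qed.

Fixpoint spread S u a k : {set V} :=
  if k is k'.+1 then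
    let A := spread S u a k' in
    A :|: [set y in S | [exists x in A, E (a + k') x y]]
  else [set u].

Lemma spread_tour S u a k v : v \in spread S u a k -> tour a u (a + k) v set0.
Proof.
elim: k v => [|k IHk] v /=.
  by rewrite inE addn0 => /eqP->; apply: tour_nil; rewrite sub0set.
rewrite inE addnS => /orP[/IHk h|].
  by apply: tour_step h _ _; rewrite ?eqxx ?sub0set.
rewrite inE => /andP[_ /exists_inP[x /IHk h e]].
by apply: tour_step h _ _; rewrite ?e ?orbT ?sub0set.
Qed.

(** While [v] is missing, every snapshot joining [u] to [v] inside [S] has an edge that leaves the
    set reached so far, so this set gains a vertex. *)
Lemma spread_card S u v a k : u \in S -> v \notin spread S u a k ->
  [/\ u \in spread S u a k, spread S u a k \subset S
    & \sum_(a <= t < a + k) conn_in S t u v < #|spread S u a k|].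
Proof.
move=> uS; elim: k => [|k IHk] /=.
  by rewrite addn0 big_geq // cards1 set11 sub1set.
rewrite inE negb_or => /andP[v1 v2].
have [uA AS lt] := IHk v1; set A := spread S u a k in uA AS lt v1 v2 *.
have AS' : A :|: [set y in S | [exists x in A, E (a + k) x y]] \subset S.
  by rewrite subUset AS; apply/subsetP => y; rewrite inE => /andP[].
rewrite addnS big_nat_recr ?leq_addr //= inE uA; split=> //.
case c: (conn_in S (a + k) u v); last first.
  by rewrite addn0; apply: leq_trans lt _; apply: subset_leq_card; apply: subsetUl.
have [x [y [xA yA /and3P[exy xS yS]]]] := connect_leave c uA v1.
rewrite addn1; apply: (@leq_ltn_trans #|A|) => //; apply: proper_card.
apply/properP; split; first exact: subsetUl.
exists y => //; rewrite !inE yS; apply/orP; right; apply/exists_inP.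
by exists x.
Qed.

(* The criterion is symmetric in u and v, which is what makes round trips
   possible. *)
Lemma tour_of_conn S k u v a b :
  0 < k -> #|S| <= k -> a <= b -> k <= \sum_(a <= t < b) conn_in S t u v ->
  tour a u b v [set v].
Proof.
move=> k0 Sk leab cnt.
have [->|neq] := eqVneq u v; first exact: tour_wait.
have uS : u \in S.
  (* A vertex outside [S] is joined only to itself, so the count would vanish. *)
  apply/negPn/negP => uS; suff : \sum_(a <= t < b) conn_in S t u v = 0 by lia.
  apply: big1 => t _; case c: (conn_in S t u v) => //.
  have [|x [y [/set1P-> _]]] := connect_leave c (set11 u).
    by rewrite inE eq_sym.
  by rewrite /= (negPf uS) andbF.
have [vin|vnin] := boolP (v \in spread S u a (b - a)).
  by move/spread_tour/tour_end: vin; rewrite subnKC // setU0.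
(* Otherwise more than [k] vertices of [S] would have been reached. *)
have [_ sub lt] := spread_card uS vnin.
by move/subset_leq_card: sub; rewrite subnKC // in lt; lia.
Qed.

Lemma tour_any k u v a : (forall t, connected_graph (E t)) -> #|V| <= k ->
  tour a u (a + k) v [set v].
Proof.
move=> con leVk; apply: (@tour_of_conn setT k); rewrite ?cardsT ?leq_addr //.
  by apply: leq_trans leVk; apply/card_gt0P; exists u.
rewrite -[leqLHS](addKn a) -{1}[a + k - a]muln1 -sum_nat_const_nat.
apply: leq_sum => t _; rewrite lt0b /conn_in.
rewrite (eq_connect (e' := E t)); first exact: con.
by move=> x y /=; rewrite !inE !andbT.
Qed.

End Exploration.

(** * Visiting part of a block from one of its hubs *)

Section BlockTours.
Variables (V : finType) (E : nat -> sgraph V).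
Implicit Types (S B X A : {set V}) (u v x y : V).

Definition linked S B g h x t : bool := conn_in E S t x g && conn_in E B t g h.

(** The window is cut where the count reaches [k]: the first part suffices to go from [g] to [x],
    the second to come back. *)
Lemma round_trip S g k x a b :
  0 < k -> #|S| <= k -> a <= b ->
  2 * k <= \sum_(a <= t < b) conn_in E S t x g ->
  tour E a g b g [set x].
Proof.
move=> k0 Sk leab cnt.
have le1 : k <= \sum_(a <= t < b) conn_in E S t x g by lia.
have [c [/andP[ac cb] ck e]] := sum_crossing leab le1.
have t1 : tour E a g c x [set x].
  apply: (@tour_of_conn _ _ S k) => //.
  by under eq_bigr do rewrite conn_in_sym; rewrite ck.
have t2 : tour E c x b g [set g].
  by apply: (@tour_of_conn _ _ S k) => //; lia.
by apply: tour_sub (tour_cat t1 t2); apply: subsetUl.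
Qed.

(* Windows in which g and h are linked too rarely before (or after) do not leave
   time to travel from h to g (or back); there are at most D of each kind. The
   cyclic shift r spreads the vertices of X over distinct windows. *)
Lemma chunk_tour S B g h M1 M D K q s X :
  0 < M1 -> 0 < M -> #|S| <= M1 -> #|B| <= M -> M + 2 * M1 <= 2 * M1 * D ->
  #|X| <= K ->
  exists A, [/\ A \subset X, tour E s h (s + K * q) h A
    & \sum_(x in X) \sum_(i < K)
        (2 * M1 <= \sum_(s + i * q <= t < s + i.+1 * q) linked S B g h x t)
      <= K * #|A| + 2 * D * #|X|].
Proof.
move=> M10 M0 SM1 BM leD.
(* The cyclic shift uses the additive group on ['I_K.+1], so [K = 0] is treated apart. *)
case: K => [|K] XK.
  exists set0; rewrite sub0set cards0; split=> //.
    by apply: tour_sub (tour_wait _ _ (leq_addr _ _)); apply: sub0set.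
  by rewrite big1 // => x _; rewrite big_ord0.
set P := fun x i => 2 * M1 <= \sum_(s + i * q <= t < s + i.+1 * q) linked S B g h x t.
pose f i := \sum_(s + i * q <= t < s + i.+1 * q) conn_in E B t g h.
have lewin i : s + i * q <= s + i.+1 * q by rewrite leq_add2l leq_mul2r leqnSn orbT.
pose after i := M <= \sum_(k < i) f k.
pose before i := M <= \sum_(i.+1 <= k < K.+1) f k.
have Pf x i : P x i -> 2 * M1 <= f i.
  move=> h1; apply: leq_trans h1 _; apply: leq_sum => t _.
  by rewrite /linked; case: (conn_in E B t g h); rewrite ?andbF ?leq_b1.
have Pround x i : P x i -> tour E (s + i * q) g (s + i.+1 * q) g [set x].
  move=> h1; apply: (@round_trip S g M1) => //; apply: leq_trans h1 _.
  by apply: leq_sum => t _; rewrite /linked; case: (conn_in E S t x g); rewrite ?leq_b1.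
have Fsum i : \sum_(k < i) f k = \sum_(s <= t < s + i * q) conn_in E B t g h.
  by rewrite -(big_mkord xpredT) sum_windows // mul0n addn0.
(* The default of [inord] never occurs on [X], which has at most [K.+1] elements. *)
pose idx x : 'I_K.+1 := inord (index x (enum X)).
have idx_inj : {in X &, injective idx}.
  move=> x y xX yX /(congr1 val); rewrite /= !inordK.
  - by move=> /(congr1 (nth x (enum X))); rewrite !nth_index ?mem_enum.
  - by rewrite (leq_trans _ XK) // cardE index_mem mem_enum.
  - by rewrite (leq_trans _ XK) // cardE index_mem mem_enum.
pose ok x (i : 'I_K.+1) := [&& P x i, after i & before i].
pose A (r : 'I_K.+1) := [set x in X | ok x (idx x + r)%R].
(* For fixed [x] the window [idx x + r] runs once through all windows as [r] varies, so the sizes of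
   the sets [A r] add up to the number of [ok] pairs. *)
have [r rmax] := exists_ge_average ord0 (fun r => #|A r|).
exists (A r); split.
- by apply/subsetP => x; rewrite inE => /andP[].
- pose tau x : 'I_K.+1 := (idx x + r)%R.
  have tau_inj : {in X &, injective tau}.
    by move=> x y xX yX /GRing.addIr; apply: idx_inj.
  have go i : i <= K.+1 -> after i ->
      tour E s h (s + i * q) g [set x in A r | tau x < i].
    elim: i => [|i IHi] leiK; first by rewrite /after big_ord0; lia.
    (* If [after] first holds at [i.+1], the agent has just had time to reach [g]; no vertex of
       [A r] is scheduled earlier, since [ok] demands [after] at its window. *)
    have [ai _|nai ai1] := boolP (after i); last first.
      have -> : [set x in A r | tau x < i.+1] = set0.
        apply/setP => x; rewrite !inE; apply/negP => /andP[/andP[_ /and3P[_ aft _]]].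
        rewrite ltnS => le_i; move/negP: nai; apply; apply: leq_trans aft _.
        rewrite -/(tau x) !Fsum [leqRHS](big_cat_nat (n := s + tau x * q)) ?leq_addr //=.
        by rewrite leq_add2l leq_mul2r le_i orbT.
      apply: (tour_sub (sub0set [set g])).
      apply: (@tour_of_conn _ _ B M) => //; rewrite ?leq_addr //.
      by under eq_bigr do rewrite conn_in_sym; rewrite -Fsum.
    have t1 := IHi (ltnW leiK) ai.
    have [/exists_inP[x xA /eqP ex]|none] := boolP [exists x in A r, tau x == i :> nat].
      have Px : P x i by move: (xA); rewrite inE -ex => /andP[_ /and3P[]].
      apply: tour_sub (tour_cat t1 (Pround _ _ Px)); apply/subsetP => y.
      rewrite in_set => /andP[yA]; rewrite ltnS leq_eqVlt => /predU1P[ey|lti].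
        have -> : y = x; last by rewrite in_setU set11 orbT.
        apply: tau_inj; [by move: yA; rewrite in_set => /andP[] | | ].
          by move: xA; rewrite in_set => /andP[].
        by apply: ord_inj; rewrite ey ex.
      by rewrite in_setU in_set yA lti.
    apply: tour_sub (tour_cat t1 (tour_wait _ _ (lewin i))); apply/subsetP => y.
    rewrite in_set => /andP[yA]; rewrite ltnS leq_eqVlt => /predU1P[ey|lti].
      by case/negP: none; apply/exists_inP; exists y => //; apply/eqP.
    by rewrite in_setU in_set yA lti.
  have [->|[x0 x0A]] := set_0Vmem (A r).
    by apply: tour_sub (tour_wait _ _ (leq_addr _ _)); apply: sub0set.
  (* Once the last scheduled vertex is visited, [before] at its window leaves time to return to
     [h]. *)
  case: (arg_maxnP (fun x => val (tau x)) x0A) => x xA xmax.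
  have: x \in A r := xA; rewrite in_set => /andP[_ /and3P[_ aft bef]].
  have aft1 : after (tau x).+1.
    by apply: leq_trans aft _; rewrite -/(tau x) big_ord_recr leq_addr.
  have t1 := go _ (ltn_ord (tau x)) aft1.
  have t2 : tour E (s + (tau x).+1 * q) g (s + K.+1 * q) h [set h].
    apply: (@tour_of_conn _ _ B M) => //.
      by rewrite leq_add2l leq_mul2r ltn_ord orbT.
    by rewrite -sum_windows // ltn_ord.
  apply: tour_sub (tour_cat t1 t2); apply/subsetP => y yA.
  by rewrite in_setU in_set yA ltnS; apply/orP; left; apply: xmax.
(* A window with [P x i] is heavy for [f], so it fails to be [ok] only if it is counted in [pre] or
   [suf], neither of which depends on [x]. *)
have cpre := (prefix_heavy_count f (2 * M1) M K.+1).2.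
have csuf := (suffix_heavy_count f (2 * M1) M K.+1).2.
set pre := \sum_(i < K.+1) _ in cpre; set suf := \sum_(i < K.+1) _ in csuf.
have preD : pre <= D.
  by rewrite -(@leq_pmul2l (2 * M1)) ?muln_gt0 //; apply: leq_trans leD.
have sufD : suf <= D.
  by rewrite -(@leq_pmul2l (2 * M1)) ?muln_gt0 //; apply: leq_trans leD.
apply: (@leq_trans (\sum_(x in X) (\sum_(i < K.+1) ok x i + (pre + suf)))).
  apply: leq_sum => x xX; rewrite -!big_split /=; apply: leq_sum => i _.
  rewrite -/(P x i) /ok /after /before; case Px: (P x i) => //=.
  rewrite (Pf _ _ Px) /=.
  by case: (leqP M (\sum_(k < i) _)); case: (leqP M (\sum_(i.+1 <= k < K.+1) _)).
rewrite big_split /= sum_nat_const; apply: leq_add; last by nia.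
have <- : \sum_r #|A r| = \sum_(x in X) \sum_(i < K.+1) ok x i; last first.
  by rewrite card_ord in rmax.
transitivity (\sum_(r' < K.+1) \sum_(x in X) ok x (idx x + r')%R).
  apply: eq_bigr => r' _; rewrite -sum1dep_card big_mkcondr /=.
  by apply: eq_bigr => x _; case: (ok _ _).
rewrite exchange_big /=; apply: eq_bigr => x _.
by rewrite [RHS](reindex_inj (GRing.addrI (idx x))).
Qed.

Lemma card_level_ltS X (lev : V -> nat) j :
  #|[set x in X | lev x < j.+1]| =
  #|[set x in X | lev x < j]| + #|[set x in X | lev x == j]|.
Proof.
rewrite -cardsUI [X in _ = _ + X]eq_card0 ?addn0; last first.
  by move=> x; rewrite !inE; case: eqP => [->|]; rewrite ?ltnn ?andbF.
by apply: eq_card => x; rewrite !inE -andb_orr ltnS leq_eqVlt orbC.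
Qed.

Lemma sum_card_level X (lev : V -> nat) n :
  \sum_(j < n) #|[set x in X | lev x == j]| = #|[set x in X | lev x < n]|.
Proof.
elim: n => [|n IHn]; last by rewrite big_ord_recr /= IHn card_level_ltS.
by rewrite big_ord0; apply/esym/eq_card0 => x; rewrite !inE andbF.
Qed.

(** The hub [h l] of the block is fixed for all substrips, so that consecutive chunk tours join up;
    the hub [g j l'] is chosen anew in each substrip. *)
Lemma block_tour (L : finType) (l0 : L) B (h : L -> V) J (S : nat -> {set V})
    (g : nat -> L -> V) (lev : V -> nat) M1 M D X s :
  0 < M1 -> 0 < M -> 0 < D -> #|B| <= M -> (forall j, #|S j| <= M1) ->
  M + 2 * M1 <= 2 * M1 * D -> M1 <= 4 * D * #|L| ^ 2 ->
  (forall j, j < J -> S j \subset B) ->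
  (forall x, x \in X -> lev x < J /\ x \in S (lev x)) ->
  (forall j t x, x \in S j -> exists l, conn_in E (S j) t x (g j l)) ->
  (forall t x, x \in B -> exists l, conn_in E B t x (h l)) ->
  exists l A, [/\ A \subset X,
    tour E s (h l) (s + J * (4 * D * #|L| ^ 2 * (2 * M1 * #|L| ^ 2))) (h l) A
    & #|X| <= 2 * #|L| ^ 2 * #|A|].
Proof.
move=> M10 M0 D0 BM SM1 leD M1K SB Xlev hubS hubB.
have L0 : 0 < #|L| by apply/card_gt0P; exists l0.
(* Each snapshot offers one of [#|L| ^ 2] labels, so in [q] snapshots some label occurs [2 * M1]
   times. The choice of [K] makes the windows lost to travel, after multiplication by [#|L| ^ 2], at
   most half of [K * #|X|]. *)
set K := 4 * D * #|L| ^ 2; set q := 2 * M1 * #|L| ^ 2.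
pose Xj j := [set x in X | lev x == j].
pose s_ j := s + j * (K * q).
pose P j l l' x i :=
  2 * M1 <= \sum_(s_ j + i * q <= t < s_ j + i.+1 * q) linked (S j) B (g j l') (h l) x t.
pose e j l l' := \sum_(x in Xj j) \sum_(i < K) P j l l' x i.
have XjS j x : x \in Xj j -> j < J /\ x \in S j.
  by rewrite inE => /andP[/Xlev[h1 h2] /eqP <-].
have has_label j x i : x \in Xj j -> 0 < \sum_(p : L * L) P j p.1 p.2 x i.
  move=> /XjS[jJ xS].
  have [p hp] := exists_ge_average (l0, l0)
    (fun p : L * L => \sum_(s_ j + i * q <= t < s_ j + i.+1 * q)
                         linked (S j) B (g j p.2) (h p.1) x t).
  suff Pp : P j p.1 p.2 x i by rewrite (bigD1 p) //= Pp.
  have L20 : 0 < #|L| ^ 2 by rewrite expn_gt0 L0.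
  rewrite /P -(leq_pmul2l L20).
  move: hp; rewrite card_prod mulnn; apply: leq_trans.
  rewrite exchange_big /=.
  have -> : #|L| ^ 2 * (2 * M1) = s_ j + i.+1 * q - (s_ j + i * q).
    by rewrite subnDl -mulnBl subSnn mul1n mulnC.
  rewrite -[leqLHS]muln1 -sum_nat_const_nat; apply: leq_sum => t _.
  have [l' c1] := hubS j t x xS.
  have gB : g j l' \in B by apply: (subsetP (SB _ jJ)); apply: conn_in_mem c1.
  have [l c2] := hubB t _ gB.
  by rewrite (bigD1 (l, l')) //= /linked c1 c2.
have eK j : K * #|Xj j| <= \sum_l \sum_l' e j l l'.
  rewrite pair_big /= exchange_big /= mulnC -sum_nat_const; apply: leq_sum => x xX.
  rewrite exchange_big /= -[leqLHS]muln1 -{1}[K]card_ord -sum_nat_const.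
  by apply: leq_sum => i _; apply: has_label.
have eX : [set x in X | lev x < J] = X.
  by apply/setP => x; rewrite inE; case: (boolP (x \in X)) => //= /Xlev[].
have [l lmax] := exists_ge_average l0 (fun l => \sum_(j < J) \sum_l' e j l l').
have KX : K * #|X| <= #|L| * \sum_(j < J) \sum_l' e j l l'.
  apply: leq_trans lmax; rewrite exchange_big /= -{1}eX -sum_card_level big_distrr /=.
  by apply: leq_sum => j _; apply: eK.
have run n : n <= J -> exists A, [/\ A \subset [set x in X | lev x < n],
    tour E s (h l) (s_ n) (h l) A
    & \sum_(j < n) \sum_l' e j l l' <=
      #|L| * (K * #|A| + 2 * D * #|[set x in X | lev x < n]|)].
  elim: n => [|n IHn] nJ.
    exists set0; rewrite sub0set big_ord0 /s_ mul0n addn0; split=> //.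
    by apply: tour_nil; apply: sub0set.
  have [A [AX tA hA]] := IHn (ltnW nJ).
  have [l' l'max] := exists_ge_average l0 (e n l).
  have XK : #|Xj n| <= K.
    apply: leq_trans M1K; apply: leq_trans (SM1 n); apply: subset_leq_card.
    by apply/subsetP => x /XjS[].
  have [A' [A'X tA' hA']] :=
    chunk_tour (g n l') (h l) q (s_ n) M10 M0 (SM1 n) BM leD XK.
  exists (A :|: A'); split.
  - apply/subsetP => x; rewrite !inE => /orP[/(subsetP AX)|/(subsetP A'X)];
    by rewrite !inE => /andP[-> h1] /=; lia.
  - have -> : s_ n.+1 = s_ n + K * q by rewrite /s_ mulSnr addnA.
    exact: tour_cat tA'.
  have disj : [disjoint A & A'].
    rewrite disjoint_subset; apply/subsetP => x /(subsetP AX).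
    rewrite !inE => /andP[xX ltx]; apply/negP => /(subsetP A'X).
    by rewrite inE => /andP[_ /eqP ex]; rewrite ex ltnn in ltx.
  rewrite big_ord_recr /= card_level_ltS cardsU (disjoint_setI0 disj) cards0 subn0.
  have h1 : \sum_l' e n l l' <= #|L| * (K * #|A'| + 2 * D * #|Xj n|).
    by apply: leq_trans l'max _; rewrite leq_mul2l hA' orbT.
  apply: leq_trans (leq_add hA h1) _; rewrite -mulnDr leq_mul2l.
  by apply/orP; right; rewrite !mulnDr addnACA.
have [A [AX tA hA]] := run J (leqnn J).
exists l, A; rewrite eX in AX hA; split=> //.
have K0 : 0 < K by rewrite /K !muln_gt0 D0 L0.
rewrite -(leq_pmul2l K0).
have eK2 : K = 2 * (#|L| ^ 2 * (2 * D)) by rewrite /K; lia.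
have : K * #|X| <= #|L| ^ 2 * (K * #|A| + 2 * D * #|X|).
  by apply: leq_trans KX _; rewrite -mulnn -mulnA leq_mul2l hA orbT.
move: (#|L| ^ 2) (#|X|) (#|A|) eK2 => z w a' eK2 h1.
have e1 : K * w = 2 * (z * (2 * D) * w) by rewrite eK2 -mulnA.
have e2 : z * (K * a' + 2 * D * w) = z * (K * a') + z * (2 * D) * w.
  by rewrite mulnDr mulnA mulnA.
have e3 : K * (2 * z * a') = 2 * (z * (K * a')) by lia.
by lia.
Qed.

End BlockTours.

(** * Iterated rounds, and tours as temporal walks *)

Section Rounds.
Variables (V : finType) (E : nat -> sgraph V) (len P : nat).
Hypothesis P_gt0 : 0 < P.
Hypothesis round : forall a u (X : {set V}), exists v (A : {set V}),
  tour E a u (a + len) v A /\ #|X| <= P * #|A :&: X|.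

(** A round leaves at most a fraction 1 - 1/P, and (1 - 1/P)^k is at most P/(P + k); this form stays
    within the naturals and gives one half at [k = P]. *)
Lemma repeat_rounds k a u (X : {set V}) : exists v (A : {set V}),
  tour E a u (a + len * k) v A /\ (k + P) * #|X :\: A| <= P * #|X|.
Proof.
elim: k => [|k [v [A [tA hA]]]].
  exists u, set0; rewrite muln0 addn0 setD0; split=> //.
  by apply: tour_nil; apply: sub0set.
have [w [A' [tA' hA']]] := round (a + len * k) v (X :\: A).
exists w, (A :|: A'); split.
  by rewrite mulnSr addnA; apply: tour_cat tA'.
have := cardsID A' (X :\: A); rewrite -setDDl setIC.
move: #|_ :&: _| #|_ :\: A'| hA hA' => c r' hA hA' e.
by rewrite -e in hA hA'; nia.
Qed.

Lemma halving_rounds k a u (X : {set V}) : exists v (A : {set V}),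
  tour E a u (a + len * (P * k)) v A /\ 2 ^ k * #|X :\: A| <= #|X|.
Proof.
elim: k => [|k [v [A [tA hA]]]].
  exists u, set0; rewrite !muln0 addn0 setD0 mul1n; split=> //.
  by apply: tour_nil; apply: sub0set.
have [w [A' [tA' hA']]] := repeat_rounds P (a + len * (P * k)) v (X :\: A).
exists w, (A :|: A'); split.
  by rewrite mulnSr mulnDr addnA; apply: tour_cat tA'.
apply: leq_trans hA; rewrite -setDDl expnSr -mulnA leq_pmul2l ?expn_gt0 //.
by rewrite -(leq_pmul2l P_gt0) mulnA muln2 -addnn.
Qed.

Lemma explore_rounds u : exists v,
  tour E 0 u (len * (P * (trunc_log 2 #|V|).+1)) v [set: V].
Proof.
have [v [A [tA hA]]] := halving_rounds (trunc_log 2 #|V|).+1 0 u [set: V].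
exists v; suff -> : [set: V] = A by [].
apply/eqP; rewrite eqEsubset subsetT andbT -setD_eq0 -cards_eq0 -leqn0 leqNgt.
apply/negP => r0; rewrite cardsT in hA.
have := @trunc_log_ltn 2 #|V| isT; rewrite ltnNge; case/negP.
by apply: leq_trans hA; rewrite leq_pmulr.
Qed.

End Rounds.

(** Waiting leaves no trace in the walk. The end point is carried along so that the next move can be
    appended, and [within_first] makes the time of that move strictly later. *)
Lemma tour_walk (V : finType) (T : nat) (G : temporal_graph V T)
    (E : nat -> sgraph V) a u b v X :
  (forall i : 'I_T, E i = G i) -> tour E a u b v X -> b <= T ->
  exists w, [/\ temporal_walk G u w, within_first b w,
    last u [seq s.1.2 | s : tstep V T <- w] = v
    & {subset X <= visited u w}].
Proof.
move=> EG; elim=> {a u b v X} [t u X Xu|a u t v w X Y _ IH e sub] tT.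
  exists [::]; split=> // x /(subsetP Xu); by rewrite !inE.
have [W [walkW inW lastW subW]] := IH (ltnW tT).
have inW' : within_first t.+1 W by apply: sub_all inW => s; apply: leqW.
have [vw|nvw] := eqVneq v w.
  exists W; split=> //; first by rewrite -vw.
  move=> x /(subsetP sub); rewrite !inE => /orP[/eqP->|/subW]; last by rewrite inE.
  rewrite -vw -lastW -in_cons; exact: mem_last.
rewrite (negPf nvw) /= in e.
exists (rcons W ((v, w), Ordinal tT)); split.
- move: walkW; rewrite /temporal_walk all_rcons /= -EG e /= => /and3P[-> sW hW] /=.
  case: W sW hW inW lastW {subW inW'} => [|s W] /= sW hW inW lastW.
    by rewrite lastW eqxx.
  rewrite hW andbT rcons_path sW /=; apply/andP; split.
    by rewrite -lastW (last_map (fun s : tstep V T => s.1.2)).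
  have h : within_first t (s :: W) by [].
  exact: (allP h _ (mem_last s W)).
- by rewrite /within_first all_rcons /= ltnSn.
- by rewrite map_rcons last_rcons.
move=> x /(subsetP sub); rewrite /visited map_rcons -rcons_cons mem_rcons.
rewrite in_cons in_setU in_set1 => /orP[->//|/subW h].
by apply/orP; right.
Qed.

(** * Strips of the grid and a single round *)

Lemma grid_col m n (u v : 'I_m * 'I_n) : grid m n u v ->
  u.2 <= v.2.+1 /\ v.2 <= u.2.+1.
Proof. by rewrite /grid /= /grid_adj -!abszE; lia. Qed.

Section GridRound.
Variables (m n : nat) (E : nat -> sgraph ('I_m.+1 * 'I_n.+1)%type).
Hypothesis E_connected : forall t, connected_graph (E t).
Hypothesis E_grid : forall t u v, E t u v -> grid m.+1 n.+1 u v.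

Definition strip l r : {set 'I_m.+1 * 'I_n.+1} :=
  [set v : 'I_m.+1 * 'I_n.+1 | l <= v.2 < r].

(** The last strips may stick out of the grid, hence the minimum for the right end column. The
    default of [inord] arises only for empty strips. *)
Definition strip_hub l r (p : bool * 'I_m.+1) : 'I_m.+1 * 'I_n.+1 :=
  (p.2, inord (if p.1 then l else (minn r n.+1).-1)).

Lemma card_strip l w : #|strip l (l + w)| <= w * m.+1.
Proof.
case: w => [|w].
  by rewrite mul0n leqn0 cards_eq0; apply/eqP/setP => v; rewrite !inE; lia.
pose f (v : 'I_m.+1 * 'I_n.+1) : 'I_w.+1 * 'I_m.+1 := (inord (v.2 - l), v.1).
have inj : {in strip l (l + w.+1) &, injective f}.
  move=> [i j] [i' j']; rewrite !inE /= => h h' [/(congr1 val) /=].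
  rewrite !inordK; [|lia..] => e ->; congr (_, _); apply: ord_inj; lia.
rewrite -(card_in_imset inj); apply: leq_trans (max_card _) _.
by rewrite card_prod !card_ord.
Qed.

Lemma strip_has_hub l r t x : x \in strip l r ->
  exists p, conn_in E (strip l r) t x (strip_hub l r p).
Proof.
move=> xS; have := xS; rewrite inE => /andP[lx xr].
have xn := ltn_ord x.2.
have [|y z yS zS e||y] := @conn_in_hub _ E (strip l r)
  [pred v : 'I_m.+1 * 'I_n.+1 | (v.2 == l :> nat) || (v.2 == (minn r n.+1).-1 :> nat)] t x
  (ord0, inord l) (E_connected t); last first.
- rewrite inE => hy c.
  suff [p ep] : exists p, strip_hub l r p = y by exists p; rewrite ep.
  case/orP: hy => /eqP hy; [exists (true, y.1) | exists (false, y.1)];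
  by rewrite /strip_hub /= -hy inord_val -surjective_pairing.
- exact: xS.
- have [] := grid_col (E_grid e).
  move: yS zS; rewrite !inE; have := ltn_ord z.2; have := ltn_ord y.2.
  move: (y.2 : nat) (z.2 : nat) => p w; rewrite /minn; case: (ltnP r n.+1); lia.
by rewrite inE /= inordK ?eqxx //; apply: leq_ltn_trans lx xn.
Qed.

(** The agent goes to the block richest in vertices of [X], which takes at most [n.+1 * m.+1]
    snapshots, and tours it. *)
Lemma strip_round a J nb s u (X : {set 'I_m.+1 * 'I_n.+1}) :
  0 < a -> 1 < J -> a <= 16 * J * m.+1 -> n.+1 <= nb * (J * a) ->
  exists v (A : {set 'I_m.+1 * 'I_n.+1}),
    tour E s u (s + (n.+1 * m.+1 + 128 * a * J ^ 2 * m.+1 ^ 5)) v A /\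
    #|X| <= 8 * m.+1 ^ 2 * nb * #|A :&: X|.
Proof.
move=> a0 J1 aJ nnb.
have nb0 : 0 < nb by lia.
have [k kmax] := exists_ge_average (Ordinal nb0)
  (fun k => #|[set x in X | x.2 %/ (J * a) == k]|).
set Xk := [set x in X | _] in kmax.
rewrite (sum_card_level X (fun x => x.2 %/ (J * a))) card_ord in kmax.
have eX : [set x in X | x.2 %/ (J * a) < nb] = X.
  apply/setP => x; rewrite inE; case: (x \in X) => //=.
  by rewrite ltn_divLR ?muln_gt0 ?a0 //; [apply: leq_trans nnb | lia].
rewrite eX in kmax.
have cardL : #|{: bool * 'I_m.+1}| = 2 * m.+1 by rewrite card_prod card_bool card_ord.
(* Here [M] is [J * M1], so [D = J] works because J + 2 <= 2 J. Subtracting [k * J] numbers the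
   substrips from the left end of the block. *)
have [||||||||||| l [A [AX tA hA]]] := @block_tour _ E (bool * 'I_m.+1)%type (true, ord0)
  (strip (k * J * a) (k * J * a + J * a)) (strip_hub (k * J * a) (k * J * a + J * a)) J
  (fun j => strip ((k * J + j) * a) ((k * J + j) * a + a))
  (fun j => strip_hub ((k * J + j) * a) ((k * J + j) * a + a))
  (fun x => x.2 %/ a - k * J) (a * m.+1) (J * a * m.+1) J Xk (s + n.+1 * m.+1).
- by rewrite muln_gt0 a0.
- by rewrite !muln_gt0 a0; lia.
- by lia.
- exact: card_strip.
- by move=> j; apply: card_strip.
- by nia.
- by rewrite cardL; nia.
- by move=> j jJ; apply/subsetP => x; rewrite !inE; nia.
- move=> x; rewrite inE => /andP[_ /eqP ek].
  have ek' : k = x.2 %/ a %/ J :> nat by rewrite -divnMA mulnC ek.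
  have J0 : 0 < J by lia.
  have d3 := divn_eq (x.2 %/ a) J; have d4 := ltn_pmod (x.2 %/ a) J0.
  rewrite -ek' in d3; split; first by lia.
  rewrite inE subnKC; last by lia.
  by rewrite leq_divM -mulSnr ltn_ceil.
- by move=> j t x; apply: strip_has_hub.
- by move=> t x; apply: strip_has_hub.
have cardV : #|{: 'I_m.+1 * 'I_n.+1}| <= n.+1 * m.+1.
  by rewrite card_prod !card_ord mulnC.
have t1 := @tour_any _ E _ u
  (strip_hub (k * J * a) (k * J * a + J * a) l) s E_connected cardV.
exists (strip_hub (k * J * a) (k * J * a + J * a) l), A; split.
  have := tour_cat t1 tA; rewrite cardL.
  have -> : s + n.+1 * m.+1
      + J * (4 * J * (2 * m.+1) ^ 2 * (2 * (a * m.+1) * (2 * m.+1) ^ 2))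
    = s + (n.+1 * m.+1 + 128 * a * J ^ 2 * m.+1 ^ 5).
    rewrite -addnA; congr (_ + (_ + _)); rewrite !expnMn !expnS; lia.
  by apply: tour_sub; apply: subsetUr.
have /setIidPl -> : A \subset X.
  by apply: subset_trans AX _; apply/subsetP => x; rewrite inE => /andP[].
apply: leq_trans kmax _; rewrite cardL expnMn in hA.
rewrite [leqRHS](_ : _ = nb * (2 * (2 ^ 2 * m.+1 ^ 2) * #|A|)).
  by rewrite leq_mul2l hA orbT.
lia.
Qed.

End GridRound.

(** * Choice of the widths and total cost *)

Lemma strip_parameters m n : 0 < m -> 64 * m ^ 5 <= n -> exists a J nb,
  [/\ 0 < a /\ 1 < J, a <= 16 * J * m, n <= nb * (J * a), a ^ 3 * m ^ 2 <= n
    & n * m + 128 * a * J ^ 2 * m ^ 5 <= 136 * (a ^ 3 * m ^ 3) /\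
      0 < 8 * m ^ 2 * nb <= 136 * (a * m ^ 5)].
Proof.
move=> m0 le_mn.
have ex0 : exists a, a ^ 3 * m ^ 2 <= n by exists 0.
(* The width [a] is chosen maximal with [a ^ 3 * m ^ 2 <= n], which determines [n] up to a factor
   8. *)
have ub a : a ^ 3 * m ^ 2 <= n -> a <= n.
  apply: leq_trans; case: a => // a; rewrite -[leqLHS]muln1 leq_mul ?expn_gt0 ?m0 //.
  by rewrite expnS leq_pmulr ?expn_gt0.
case: (ex_maxnP ex0 ub) => a ha amax.
(* The threshold on [n] is 64 m^5 = (4 m)^3 m^2. *)
have a4 : 4 * m <= a.
  by apply: amax; rewrite expnMn -mulnA -expnD.
have lt_n : n < a.+1 ^ 3 * m ^ 2.
  by rewrite ltnNge; apply/negP => /amax; rewrite ltnn.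
have n8 : n <= 8 * a ^ 3 * m ^ 2.
  apply: leq_trans (ltnW lt_n) _.
  rewrite leq_mul2r (_ : 8 = 2 ^ 3) // -expnMn leq_exp2r //.
  by apply/orP; right; lia.
(* Then [J * m] is [a] up to a factor 2, so travelling to a block and touring it both cost O(a^3
   m^3). *)
pose J := a %/ m.
have Jm : J * m <= a by apply: leq_divM.
have aJ : a < J.+1 * m by apply: ltn_ceil.
have J4 : 4 <= J by rewrite /J leq_divRL.
have a2 : a <= 2 * (J * m) by nia.
have a0 : 0 < a by lia.
have d0 : 0 < J * a by rewrite muln_gt0 a0; lia.
exists a, J, (n %/ (J * a)).+1; split=> //.
- by split=> //; lia.
- by apply: leq_trans a2 _; rewrite -mulnA leq_mul2r orbT.
- by apply/ltnW/ltn_ceil.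
(* The constant 136 is 8 + 128 in the first bound and 8 times 17 in the second. *)
split.
  have h1 : n * m <= 8 * (a ^ 3 * m ^ 3).
    by apply: leq_trans (leq_mul n8 (leqnn m)) _; rewrite !expnS !expn0; lia.
  have h2 : 128 * a * J ^ 2 * m ^ 5 <= 128 * (a ^ 3 * m ^ 3).
    rewrite (_ : _ * m ^ 5 = 128 * a * (J * m) ^ 2 * m ^ 3); last first.
      by rewrite expnMn (expnD m 2 3); lia.
    rewrite (_ : 128 * (_ * _) = 128 * a * a ^ 2 * m ^ 3); last first.
      by rewrite (expnS a 2); lia.
    by rewrite leq_mul2r leq_mul2l leq_exp2r // Jm !orbT.
  by apply: leq_trans (leq_add h1 h2) _; rewrite -mulnDl.
rewrite !muln_gt0 m0 /=.
have nb17 : (n %/ (J * a)).+1 <= 17 * (a * m ^ 3).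
  have am0 : 0 < a * m ^ 3 by rewrite muln_gt0 a0 expn_gt0 m0.
  have : n %/ (J * a) <= 16 * (a * m ^ 3).
    rewrite -[leqRHS](mulnK _ d0) leq_div2r //; apply: leq_trans n8 _.
    rewrite (_ : 8 * _ * _ = (8 * a ^ 2 * m ^ 2) * a); last by rewrite (expnSr a 2); lia.
    rewrite (_ : 16 * _ * _ = (8 * a ^ 2 * m ^ 2) * (2 * (J * m))).
      by rewrite leq_mul2l a2 orbT.
    by rewrite (expnSr m 2) -(mulnn a); lia.
  lia.
apply: (@leq_trans (8 * m ^ 2 * (17 * (a * m ^ 3)))).
  by rewrite leq_mul2l nb17 orbT.
by rewrite (expnD m 2 3); lia.
Qed.

Definition grid_rounds m n len P :=
  forall E : nat -> sgraph ('I_m * 'I_n)%type,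
  (forall t, connected_graph (E t)) ->
  (forall t u v, E t u v -> grid m n u v) ->
  forall a u (X : {set 'I_m * 'I_n}), exists v (A : {set 'I_m * 'I_n}),
    tour E a u (a + len) v A /\ #|X| <= P * #|A :&: X|.

Lemma grid_rounds_single m n : grid_rounds m n (n * m) (n * m).
Proof.
move=> E conE _ a u X.
have cardV : #|{: 'I_m * 'I_n}| = n * m by rewrite card_prod !card_ord mulnC.
have [->|[x xX]] := set_0Vmem X.
  by exists u, [set u]; rewrite cards0; split=> //; apply/tour_wait/leq_addr.
exists x, [set x]; split; first by apply: tour_any; rewrite ?cardV.
rewrite (setIidPl _) ?sub1set // cards1 muln1 -cardV; exact: max_card.
Qed.

(** The cost is cubed so that the exponents 4/3 and 16/3 become integers. *)
Lemma grid_schedule m n : 0 < m -> 0 < n -> exists len P,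
  [/\ 0 < len, 0 < P, grid_rounds m n len P
    & (len * P) ^ 3 <= (136 ^ 2) ^ 3 * (n ^ 4 * m ^ 16)].
Proof.
move=> m0 n0; have [le_mn|lt_nm] := leqP (64 * m ^ 5) n.
  have [a [J [nb [[a0 J1] aJ nnb an [len_le /andP[P0 P_le]]]]]] :=
    strip_parameters m0 le_mn.
  exists (n * m + 128 * a * J ^ 2 * m ^ 5), (8 * m ^ 2 * nb); split=> //.
  - by rewrite addn_gt0 muln_gt0 n0 m0.
  - case: m n m0 n0 aJ nnb {le_mn an len_le P_le P0} => // m [] // n _ _ aJ nnb.
    by move=> E conE gridE s u X; apply: strip_round.
  apply: (@leq_trans ((136 ^ 2 * (a ^ 4 * m ^ 8)) ^ 3)).
    rewrite leq_exp2r //; apply: leq_trans (leq_mul len_le P_le) _.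
    by rewrite (expnSr a 3) (expnD m 3 5) mulnACA [X in _ * X]mulnACA mulnn.
  rewrite expnMn leq_pmul2l ?expn_gt0 // expnMn -!expnM.
  apply: (@leq_trans ((a ^ 3 * m ^ 2) ^ 4 * m ^ 16)).
    by rewrite expnMn -!expnM -mulnA -expnD.
  by rewrite leq_mul2r leq_exp2r // an orbT.
(* The cube of (n m)^2 is n^4 n^2 m^6, and n < 64 m^5 bounds n^2 m^6 by 64^2 m^16. *)
exists (n * m), (n * m); rewrite muln_gt0 m0 n0; split=> //.
  exact: grid_rounds_single.
apply: (@leq_trans (n ^ 4 * n ^ 2 * m ^ 6)).
  by rewrite -expnD mulnn -expnM expnMn.
rewrite -mulnA [leqRHS]mulnCA leq_pmul2l ?expn_gt0 ?n0 //.
apply: (@leq_trans ((64 * m ^ 5) ^ 2 * m ^ 6)).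
  by rewrite leq_mul2r leq_exp2r // (ltnW lt_nm) orbT.
rewrite expnMn -expnM -mulnA -expnD; apply: leq_mul (leqnn _).
by apply: (@leq_trans (136 ^ 2)); [rewrite leq_exp2r | rewrite -expnM leq_pexp2l].
Qed.

(** * Real estimates and the theorem *)

Import Order.TTheory GRing.Theory Num.Theory.

Local Open Scope ring_scope.

Lemma le_powR_thirds (R : realType) (z c m n : nat) :
  (z ^ 3 <= c ^ 3 * (n ^ 4 * m ^ 16))%N ->
  z%:R <= c%:R * (n%:R `^ (4 / 3) * m%:R `^ (16 / 3)) :> R.
Proof.
have cube (k p : nat) : (k%:R `^ (p%:R / 3)) ^+ 3 = (k ^ p)%:R :> R.
  rewrite -powR_mulrn ?powR_ge0 // -powRrM divfK ?pnatr_eq0 //.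
  by rewrite powR_mulrn ?ler0n // natrX.
move=> le_z.
rewrite -(@ler_pXn2r _ 3) ?nnegrE ?mulr_ge0 ?powR_ge0 ?ler0n //.
by rewrite !exprMn (cube n 4%N) (cube m 16%N) -!natrX -!natrM ler_nat.
Qed.

Lemma ln2_ge_half (R : realType) : 1 / 2 <= ln 2 :> R.
Proof.
have h : ln (2^-1 : R) <= - (1 / 2).
  rewrite -[leRHS]expRK ler_ln ?posrE ?invr_gt0 ?expR_gt0 ?ltr0n //.
  by apply: le_trans (expR_ge1Dx _); lra.
by move: h; rewrite lnV ?posrE ?ltr0n //; lra.
Qed.

(** As [N] is at least 4, its logarithm is at least 2 ln 2 >= 1 and hence at most its power 5/2; the
    factor 3 is 2 from ln 2 >= 1/2 and 1 from the successor. *)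
Lemma trunc_log_le_powR_ln (R : realType) (N : nat) : (4 <= N)%N ->
  (trunc_log 2 N).+1%:R <= 3 * ln N%:R `^ (5 / 2) :> R.
Proof.
move=> N4; have N0 : (0 < N)%N by apply: leq_trans N4.
have ln2 := ln2_ge_half R.
have lnXle k : (2 ^ k <= N)%N -> k%:R * ln 2 <= ln N%:R :> R.
  move=> le_N; rewrite mulr_natl -lnXn ?ltr0n // ler_ln ?posrE ?exprn_gt0 ?ltr0n //.
  by rewrite -natrX ler_nat.
have h1 := lnXle 2%N N4.
have h2 := lnXle _ (trunc_logP (isT : 1 < 2)%N N0).
have ln1 : 1 <= ln N%:R :> R by lra.
have h3 : ln N%:R <= ln N%:R `^ (5 / 2) :> R.
  by rewrite -[leLHS]powRr1 ?(le_trans ler01) // ler_powR //; lra.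
rewrite -natr1; have : (trunc_log 2 N)%:R <= 2 * ln N%:R :> R.
  by have := ler0n R (trunc_log 2 N); nra.
lra.
Qed.

(** Every vertex has a neighbour. This allows the factor [Delta] to be bounded below by 1 in the
    theorem. *)
Lemma avg_degree_ge1 (R : realType) (V : finType) (G : sgraph V) :
  connected_graph G -> (1 < #|V|)%N -> 1 <= avg_degree R G.
Proof.
move=> conG V1; rewrite /avg_degree ler_pdivlMr ?ltr0n ?(ltnW V1) // mul1r ler_nat.
rewrite -[leqLHS]muln1 -sum_nat_const; apply: leq_sum => v _.
have [w wv] : exists w, w != v.
  apply/existsP; rewrite -negb_forall; apply: contraL V1 => /forallP all_v.
  by rewrite -leqNgt; apply/fintype_le1P => x y; rewrite (eqP (all_v x)) (eqP (all_v y)).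
have [x [y [/set1P-> _ vy]]] : exists x y, [/\ x \in [set v], y \notin [set v] & G x y].
  by apply: connect_leave (conG v w) _ _; rewrite !inE.
by apply/card_gt0P; exists y; rewrite inE.
Qed.

Lemma grid_nonempty m n (i : 'I_m) : (1 < n)%N -> exists u v, grid m n u v.
Proof.
move=> n1; exists (i, Ordinal (ltnW n1)), (i, Ordinal n1).
by rewrite /grid /= /grid_adj /= subrr.
Qed.

Theorem theorem6 (R : realType) :
  exists C : R, 0 < C /\
  forall (m n T : nat) (G : temporal_graph ('I_m * 'I_n)%type T),
    (2 <= m)%N -> (2 <= n)%N ->
    always_connected G ->
    underlying G =2 grid m n ->
    let Delta : R := avg_degree R (underlying G) in
    let f : R := n%:R `^ (4 / 3) * m%:R `^ (16 / 3) * Delta `^ (3 / 2)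
                 * ln (n * m)%N%:R `^ (5 / 2) in
    C * f <= T%:R ->
    forall v0 : ('I_m * 'I_n)%type,
      explorable_from G v0 `|Num.ceil (C * f)|%N.
Proof.
(* The square comes from the length of a round and the number of rounds per halving, the 3 from the
   logarithm. *)
exists ((136 ^ 2)%N%:R * 3); split; first by rewrite mulr_gt0 // ltr0n expn_gt0.
move=> m n T G m2 n2 conG gridG Delta f; set C := _ * 3 => leT v0.
have [len [P [len0 P0 rounds le_cube]]] := grid_schedule (ltnW m2) (ltnW n2).
have N4 : (4 <= n * m)%N by rewrite (leq_mul n2 m2).
have cardV : #|{: 'I_m * 'I_n}| = (n * m)%N by rewrite card_prod !card_ord mulnC.
(* An edge of the grid must occur in some snapshot, so there is at least one. *)
have [u [v]] := grid_nonempty v0.1 n2; rewrite -gridG => /existsP[i0 _].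
have Delta1 : 1 <= Delta `^ (3 / 2).
  rewrite -[leLHS](powRr0 Delta); apply: ler_powR; last by rewrite divr_ge0.
  apply: avg_degree_ge1; last by rewrite cardV (leq_trans _ N4).
  move=> x y; apply: connect_sub (conG i0 x y) => {}x {}y Gxy.
  by apply: connect1; apply/existsP; exists i0.
pose k := (len * (P * (trunc_log 2 #|{: 'I_m * 'I_n}|).+1))%N.
have le_k : k%:R <= C * f.
  have h1 := le_powR_thirds R le_cube.
  have h2 := trunc_log_le_powR_ln R N4.
  rewrite /k cardV mulnA natrM.
  apply: le_trans (ler_pM _ _ h1 h2) _; rewrite ?ler0n //.
  rewrite /C /f; set y := n%:R `^ _ * _; set l := ln _ `^ _.
  rewrite (_ : _ * (3 * l) = (136 ^ 2)%N%:R * 3 * (y * 1 * l)); last by ring.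
  rewrite ler_wpM2l ?mulr_ge0 ?ler0n // ler_wpM2r ?powR_ge0 //.
  by rewrite ler_wpM2l // /y mulr_ge0 ?powR_ge0.
have Cf0 : 0 <= C * f by apply: le_trans le_k; rewrite ler0n.
have ceil0 : 0 <= Num.ceil (C * f) by rewrite ceil_ge0 (lt_le_trans _ Cf0) ?ltrN10.
have le_k_ceil : (k <= `|Num.ceil (C * f)|)%N.
  rewrite -lez_nat gez0_abs // -(ler_int R) /=.
  by apply: le_trans le_k (ceil_ge _).
have le_ceil_T : (`|Num.ceil (C * f)| <= T)%N.
  by rewrite -lez_nat gez0_abs // ceil_le_int.
(* Tours need snapshots at all times; past [T] the snapshot [G i0] is repeated, but the tour ends by
   then. *)
pose E t := if insub t is Some i then G i else G i0.
have EG i : E (val i) = G i by rewrite /E valK.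
have Ecase t : exists i, E t = G i.
  by rewrite /E; case: insub => [i|]; [exists i | exists i0].
have conE t : connected_graph (E t) by have [i ->] := Ecase t.
have gridE t x y : E t x y -> grid m n x y.
  by have [i ->] := Ecase t => Gxy; rewrite -gridG; apply/existsP; exists i.
have [w tour_w] := explore_rounds P0 (rounds E conE gridE) v0.
have [W [walkW inW _ subW]] := tour_walk EG tour_w (leq_trans le_k_ceil le_ceil_T).
exists W; split=> //; last by move=> x; apply: subW; rewrite inE.
by apply: sub_all inW => s h; apply: leq_trans h le_k_ceil.
Qed.
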